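(* Order-preserving endofunctions $s\le t$ satisfying $s^3=s$ and $t^3=t$ on a poset $(L,\le)$ always generate one of $52$ distinct quotients of $\mathbf{Ch}(3,3)$ under composition, all of which occur. That is, as $(L,\le,s,t)$ ranges over all posets $(L,\le)$ equipped with order-preserving maps $s,t:L\to L$ such that $s\le t$, $s^3=s$, $t^3=t$, exactly $52$ distinct equivalence relations on $\{s,t\}^+$ (equivalently, on $\mathbf{Ch}(3,3)$) arise as the relation $$w_1\sim w_2\iff w_1(x)=w_2(x)\text{ for all }x\in L .$$
   Context: $\{s,t\}^+$ is the set of all nonempty finite words over $\{s,t\}$; words act on $L$ as compositions, and $s\le t$ is pointwise. $\mathbf{Ch}(3,3)$ is the quotient of $\{s,t\}^+$ identifying two words when they act identically on every poset $(L,\le)$ for all order-preserving $s,t:L\to L$ with $s\le t$, $s^3=s$, $t^3=t$. The equivalence relation $\sim$ determined by a given $(L,\le,s,t)$ is called a global collapse of $\mathbf{Ch}(3,3)$; two global collapses are counted as distinct when they are different relations (the generators $s$ and $t$ are labelled, and order-dual collapses are counted separately). *)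

(* Defs.v *)
From HB Require Import structures.
From mathcomp Require Import all_boot all_order.
From mathcomp Require Import boolp classical_sets functions cardinality.

Set Implicit Arguments.
Unset Strict Implicit.
Unset Printing Implicit Defensive.

Local Open Scope order_scope.
Local Open Scope quotient_scope.

Inductive letter := letter_s | letter_t.

Definition is_letter_t (a : letter) : bool :=
  if a is letter_t then true else false.
Definition letter_of_bool (b : bool) : letter :=
  if b then letter_t else letter_s.
Lemma is_letter_tK : cancel is_letter_t letter_of_bool.
Proof. by case. Qed.

HB.instance Definition _ := Countable.copy letter (can_type is_letter_tK).

Definition word : Type := {w : seq letter | w != [::]}.
HB.instance Definition _ := Countable.on word.

Section Action.
Variables (d : Order.disp_t) (L : porderType d) (s t : L -> L).

Definition ch33_pair : Prop :=
  [/\ {homo s : x y / x <= y}, {homo t : x y / x <= y},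
      forall x, s x <= t x,
      s \o s \o s =1 s & t \o t \o t =1 t].

Definition letter_act (a : letter) : L -> L :=
  match a with letter_s => s | letter_t => t end.

(* The word a_1 ... a_n acts as the composite a_1 o ... o a_n, the rightmost
   letter being applied first. *)
Definition act (w : word) : L -> L :=
  fun x => foldr letter_act x (val w).

Definition collapse (w1 w2 : word) : Prop := forall x : L, act w1 x = act w2 x.

End Action.

(* Identities between words valid for every admissible (L, <=, s, t). *)
Definition ch33_eq (w1 w2 : word) : Prop :=
  forall (d : Order.disp_t) (L : porderType d) (s t : L -> L),
    ch33_pair s t -> collapse s t w1 w2.

Definition ch33_eqb : rel word := fun w1 w2 => `[< ch33_eq w1 w2 >].

Lemma ch33_eqb_refl : reflexive ch33_eqb.
Proof. by move=> w; apply/asboolP. Qed.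

Lemma ch33_eqb_sym : symmetric ch33_eqb.
Proof.
by move=> v w; apply/asboolP/asboolP => h d L s t st x; rewrite (h _ _ _ _ st).
Qed.

Lemma ch33_eqb_trans : transitive ch33_eqb.
Proof.
move=> v u w /asboolP uv /asboolP vw; apply/asboolP => d L s t st x.
by rewrite (uv _ _ _ _ st) (vw _ _ _ _ st).
Qed.

Canonical ch33_equiv : equiv_rel word :=
  EquivRel ch33_eqb ch33_eqb_refl ch33_eqb_sym ch33_eqb_trans.

Definition Ch33 : Type := {eq_quot ch33_equiv}.
HB.instance Definition _ := Choice.on Ch33.
HB.instance Definition _ := EqQuotient.on Ch33.

Section QuotientAction.
Variables (d : Order.disp_t) (L : porderType d) (s t : L -> L).

(* Independent of the representative when ch33_pair s t holds: see
   act_Ch33_pi. *)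
Definition act_Ch33 (c : Ch33) : L -> L := act s t (repr c).

Lemma act_Ch33_pi (w : word) :
  ch33_pair s t -> act_Ch33 (\pi_Ch33 w) =1 act s t w.
Proof.
move=> st; have /eqmodP/asboolP h : repr (\pi_Ch33 w) = w %[mod Ch33].
  by rewrite reprK.
exact: h st.
Qed.

Definition collapse_Ch33 (c1 c2 : Ch33) : Prop :=
  forall x : L, act_Ch33 c1 x = act_Ch33 c2 x.

End QuotientAction.

(* By functional and propositional extensionality, equality of Prop-valued
   relations is extensional, so the cardinals of the following two sets count
   relations up to having the same graph. *)
Definition global_collapses : set (word -> word -> Prop) :=
  [set R | exists (d : Order.disp_t) (L : porderType d) (s t : L -> L),
     ch33_pair s t /\ R = collapse s t].

Definition global_collapses_Ch33 : set (Ch33 -> Ch33 -> Prop) :=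
  [set R | exists (d : Order.disp_t) (L : porderType d) (s t : L -> L),
     ch33_pair s t /\ R = collapse_Ch33 s t].

(* Main.v *)
(* A collapse is the kernel of a preorder on words that is compatible with
   concatenation and satisfies s <= t: a model gives the pointwise preorder, and
   conversely such a preorder, extended discretely to the empty word, is
   realised on sets of words, the letter a sending A to the down-closure of
   {a u | u in A}.  The relations stt = sst, tts = tss, stst = st, tsts = ts and
   their consequences leave only 12 elements in Ch(3,3).  Every kernel is that
   of the preorder generated by s <= t and the pairs in the kernel, so the
   collapses are enumerated by adjoining the 66 possible pairs one at a time;
   52 kernels result. *)
Require Import Defs.
From mathcomp Require Import all_boot all_order.
From mathcomp Require Import boolp classical_sets functions cardinality.

Local Open Scope classical_set_scope.
Local Open Scope card_scope.

Set Implicit Arguments.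
Unset Strict Implicit.
Unset Printing Implicit Defensive.

(** * Twelve normal forms and their multiplication, with the empty word as unit *)

Definition ch33_rep (i : nat) : seq letter :=
  let s := letter_s in let t := letter_t in
  nth [::]
    [:: [:: s]; [:: t]; [:: s; s]; [:: s; t]; [:: t; s]; [:: t; t];
        [:: s; s; t]; [:: s; t; s]; [:: t; s; s]; [:: t; s; t];
        [:: s; s; t; s]; [:: t; s; s; t]] i.

(* [lmul a i] is the index of the normal form of [a :: ch33_rep i]; index 12
   and any larger one stand for the empty word. *)
Definition lmul (a : letter) (i : nat) : nat :=
  match a with
  | letter_s => nth 0 [:: 2; 3; 0; 6; 7; 6; 3; 10; 10; 3; 7; 6] i
  | letter_t => nth 1 [:: 4; 5; 8; 9; 8; 1; 11; 4; 4; 11; 8; 9] i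
  end.

Definition nf (w : seq letter) : nat := foldr lmul 12 w.

Definition mul (i j : nat) : nat := foldr lmul j (ch33_rep i).

(** Past the end of the tables the [nth] defaults 0 and 1 apply, the indices of [s] and [t]: a
    letter put before the empty word. *)
Lemma lmul_lt a i : lmul a i < 12.
Proof. by case: a; do 12?[case: i => [|i] //]; rewrite /lmul nth_default. Qed.

Lemma nf_lt w : nf w < 13.
Proof. by case: w => [|a w] //; rewrite ltnW // ltnS lmul_lt. Qed.

Lemma nf_word_lt (w : word) : nf (val w) < 12.
Proof. by case: w => -[|a w] //= _; apply: lmul_lt. Qed.

Lemma iota13 i : (i \in iota 0 13) = (i < 13).
Proof. by rewrite mem_iota. Qed.

Lemma iota12 i : (i \in iota 0 12) = (i < 12).
Proof. by rewrite mem_iota. Qed.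

Lemma nf_rep i : i < 12 -> nf (ch33_rep i) = i.
Proof. by do 12?[case: i => [|i] //]. Qed.

(** Associativity with a letter as first factor, a finite check; induction then makes [nf]
    multiplicative. *)
Lemma lmul_mul a i j : i < 13 -> j < 13 -> lmul a (mul i j) = mul (lmul a i) j.
Proof.
move=> i13 j13; apply/eqP; move: i13 j13; rewrite -!iota13 => ii jj.
have : all (fun i => all (fun j => lmul a (mul i j) == mul (lmul a i) j)
  (iota 0 13)) (iota 0 13) by case: a; vm_compute.
by move=> /allP/(_ i ii)/allP/(_ j jj).
Qed.

Lemma nf_cat w v : nf (w ++ v) = mul (nf w) (nf v).
Proof.
by elim: w => [|a w IH] //=; rewrite -lmul_mul ?nf_lt // -IH.
Qed.

(** * Preorders as Boolean matrices, and their enumeration *)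

Definition matrix := seq (seq bool).

Definition get (m : matrix) (i j : nat) : bool := nth false (nth [::] m i) j.

Definition ins (p : nat * nat) (m : matrix) : matrix :=
  set_nth [::] m p.1 (set_nth false (nth [::] m p.1) p.2 true).

Lemma get_ins p m i j : get (ins p m) i j = ((i, j) == p) || get m i j.
Proof.
case: p => a b; rewrite /get /ins nth_set_nth /= xpair_eqE.
by case: eqP => // ->; rewrite nth_set_nth /=; case: eqP.
Qed.

Fixpoint orr (r1 r2 : seq bool) : seq bool :=
  match r1, r2 with
  | b1 :: r1', b2 :: r2' => (b1 || b2) :: orr r1' r2'
  | [::], _ => r2
  | _, [::] => r1
  end.

Lemma nth_orr r1 r2 j :
  nth false (orr r1 r2) j = nth false r1 j || nth false r2 j.
Proof.
by elim: r1 r2 j => [|b1 r1 IH] [|b2 r2] [|j] //=; rewrite ?orbF ?IH.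
Qed.

Definition warshall_step (m : matrix) (k : nat) : matrix :=
  [seq if nth false r k then orr r (nth [::] m k) else r | r <- m].

Lemma get_warshall_step m k i j :
  get (warshall_step m k) i j = get m i j || get m i k && get m k j.
Proof.
rewrite /get; case: (ltnP i (size m)) => im.
  by rewrite (nth_map [::]) //; case: ifP; rewrite ?nth_orr ?orbF.
by rewrite ![nth [::] _ i]nth_default ?size_map // !nth_nil.
Qed.

Definition adjoin (ps : seq (nat * nat)) (m : matrix) : matrix :=
  foldl warshall_step (foldr ins m ps) (iota 0 13).

(** Two-sided multiples of a pair, index 12 giving empty factors. Adjoining all of them to a
    compatible preorder keeps it compatible after transitive closure. *)
Definition translates (a b : nat) : seq (nat * nat) :=
  undup [seq (mul u (mul a v), mul u (mul b v))
        | u <- iota 0 13, v <- iota 0 13].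

Definition ch33_le : matrix :=
  adjoin (translates 0 1) (mkseq (fun i => mkseq (eq_op i) 13) 13).

(* [ps] is processed from the right; a preorder already identifying [a] and
   [b] is its own join with that pair. *)
Fixpoint joins (ps : seq (nat * nat)) : seq matrix :=
  if ps is (a, b) :: ps' then
    let ms := joins ps' in
    let gens := translates a b ++ translates b a in
    undup (ms ++ [seq adjoin gens m | m <- ms & ~~ (get m a b && get m b a)])
  else [:: ch33_le].

Definition pairs : seq (nat * nat) :=
  [seq (i, j) | i <- iota 0 12, j <- iota 0 i].

(* Locked: conversion would otherwise try to evaluate the enumeration. *)
Definition orders : seq matrix := locked (joins pairs).

Definition kernel (m : matrix) : seq bool :=
  [seq get m i j && get m j i | i <- iota 0 12, j <- iota 0 12].

Definition kernel_rel (m : matrix) (w1 w2 : word) : Prop :=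
  get m (nf (val w1)) (nf (val w2)) && get m (nf (val w2)) (nf (val w1)).

Definition valid (m : matrix) : bool :=
  let I := iota 0 13 in
  [&& all (fun i => get m i i && get m (lmul letter_s i) (lmul letter_t i)) I
    & all (fun i => all (fun j => get m i j ==>
        [&& all (fun k => get m j k ==> get m i k) I,
            get m (lmul letter_s i) (lmul letter_s j),
            get m (lmul letter_t i) (lmul letter_t j)
          & all (fun k => get m (mul i k) (mul j k)) I]) I) I].

(** The finite computation behind the number 52. Distinctness is tested on kernels, since different
    preorders could share one. *)
Lemma orders_check :
  [&& size orders == 52, uniq (map kernel orders) & all valid orders].
Proof. by rewrite /orders -lock; vm_compute. Qed.

Lemma orders_valid m : m \in orders -> valid m.
Proof.
have /andP[_ /andP[_ /allP ordersV]] := orders_check; exact: ordersV.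
Qed.

(** Warshall steps only add composites of entries already present, so they stay inside any
    transitive relation containing the input. Transitivity of the enumerated matrices is certified
    by [valid]. *)
Lemma adjoin_sound (P : nat -> nat -> Prop) ps m :
  (forall i j k, P i j -> P j k -> P i k) ->
  (forall p, p \in ps -> P p.1 p.2) ->
  (forall i j, get m i j -> P i j) ->
  forall i j, get (adjoin ps m) i j -> P i j.
Proof.
move=> Ptr; rewrite /adjoin => Pps Pm.
have: forall i j, get (foldr ins m ps) i j -> P i j.
  elim: ps Pps => [|p ps IH] //= Pps i j.
  rewrite get_ins => /orP[/eqP pij|].
    by have := Pps p (mem_head _ _); rewrite -pij.
  by apply: IH => q qps; apply: Pps; rewrite inE qps orbT.
elim: (iota 0 13) (foldr _ _ _) => [|k ks IH] //= m' Pm'.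
apply: IH => i j; rewrite get_warshall_step.
move=> /orP[/Pm' //|/andP[/Pm' ik /Pm' kj]].
exact: Ptr kj.
Qed.

Lemma adjoin_sub ps m i j : get m i j -> get (adjoin ps m) i j.
Proof.
rewrite /adjoin => mij.
have: get (foldr ins m ps) i j.
  by elim: ps => //= p ps IH; rewrite get_ins IH orbT.
elim: (iota 0 13) (foldr _ _ _) => [|k ks IH] //= m' m'ij.
by apply: IH; rewrite get_warshall_step m'ij.
Qed.

Lemma adjoin_mem ps m i j : (i, j) \in ps -> get (adjoin ps m) i j.
Proof.
rewrite /adjoin => pij.
have: get (foldr ins m ps) i j.
  elim: ps pij => //= p ps IH; rewrite inE get_ins => /orP[->//|/IH ->].
  by rewrite orbT.
elim: (iota 0 13) (foldr _ _ _) => [|k ks IH] //= m' m'ij.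
by apply: IH; rewrite get_warshall_step m'ij.
Qed.

Lemma mem_translates a b : a < 12 -> b < 12 -> (a, b) \in translates a b.
Proof.
move=> a12 b12; rewrite mem_undup; apply/allpairsP; exists (12, 12) => /=.
have mul12 i : i < 12 -> mul i 12 = i by exact: nf_rep.
by rewrite !mul12.
Qed.

(** * Completeness of the enumeration up to kernels *)

Section Completeness.
Variable P : nat -> nat -> Prop.
Hypothesis Prefl : forall i, P i i.
Hypothesis Ptr : forall i j k, P i j -> P j k -> P i k.
Hypothesis Pmul : forall u v i j,
  P i j -> P (mul u (mul i v)) (mul u (mul j v)).
Hypothesis Pst : P 0 1.

Lemma translates_sound a b p :
  P a b -> p \in translates a b -> P p.1 p.2.
Proof.
move=> Pab; rewrite mem_undup => /allpairsP[[u v]] /= [_ _ ->]; exact: Pmul.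
Qed.

Lemma ch33_le_sound i j : get ch33_le i j -> P i j.
Proof.
apply: adjoin_sound; [exact: Ptr|by move=> p; apply: translates_sound|].
move=> {}i {}j; rewrite /get.
case: (ltnP i 13) => i13; last first.
  by rewrite [nth [::] _ i]nth_default ?size_mkseq // nth_nil.
rewrite nth_mkseq //; case: (ltnP j 13) => j13; last first.
  by rewrite nth_default ?size_mkseq.
by rewrite nth_mkseq // => /eqP ->.
Qed.

(** Adjoin a pair exactly when [P] identifies it and the current matrix does not: the matrix stays
    inside [P], while its kernel absorbs the listed pairs of the kernel of [P]. *)
Lemma joins_complete ps : all (fun p => (p.1 < 12) && (p.2 < 12)) ps ->
  exists m, [/\ m \in joins ps, forall i j, get m i j -> P i j
    & forall a b, (a, b) \in ps -> P a b -> P b a -> get m a b && get m b a].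
Proof.
elim: ps => [|[a b] ps IH] /=.
  by exists ch33_le; split; [exact: mem_head|exact: ch33_le_sound|].
move=> /andP[/andP[a12 b12] /IH[m [mps mP Pm]]].
have [[Pab Pba]|nP] := pselect (P a b /\ P b a); last first.
  exists m; split=> //; first by rewrite mem_undup mem_cat mps.
  by move=> x y; rewrite inE => /orP[/eqP[-> ->] ? ?|/Pm //]; case: nP.
have [mab|mab] := boolP (get m a b && get m b a).
  exists m; split=> //; first by rewrite mem_undup mem_cat mps.
  by move=> x y; rewrite inE => /orP[/eqP[-> ->] //|/Pm].
exists (adjoin (translates a b ++ translates b a) m); split.
- rewrite mem_undup mem_cat; apply/orP; right; apply/mapP; exists m => //.
  by rewrite mem_filter mab.
- apply: adjoin_sound => // p; rewrite mem_cat => /orP[] pt.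
  + exact: translates_sound pt.
  + exact: translates_sound pt.
- move=> x y; rewrite inE => /orP[/eqP[-> ->] _ _|/Pm Pm' Pxy Pyx].
    apply/andP; split; apply: adjoin_mem; rewrite mem_cat; apply/orP.
      by left; apply: mem_translates.
    by right; apply: mem_translates.
  by have /andP[xy yx] := Pm' Pxy Pyx; rewrite !adjoin_sub.
Qed.

(** Only kernels are matched; elsewhere [m] may be strictly smaller than [P]. *)
Lemma orders_complete : exists2 m, m \in orders &
  forall i j, i < 12 -> j < 12 -> get m i j && get m j i <-> P i j /\ P j i.
Proof.
have [|m [mo mP Pm]] := @joins_complete pairs; first by vm_compute.
rewrite [joins _]lock -/orders in mo; exists m => // i j i12 j12.
have /andP[/allP mrefl _] := orders_valid mo.
split; first by move=> /andP[/mP ? /mP].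
(* [pairs] lists the larger index first; the opposite order follows by symmetry and the diagonal by
   reflexivity. *)
have mem x y : x < 12 -> y < x -> (x, y) \in pairs.
  by move=> x12 yx; apply/allpairsPdep; exists x, y; rewrite iota12 mem_iota.
move=> [Pij Pji]; have [ij|ji|->] := ltngtP i j.
- by rewrite andbC; apply: Pm => //; apply: mem.
- by apply: Pm => //; apply: mem.
- by have /andP[-> _] := mrefl j (etrans (iota13 j) (leqW j12)).
Qed.

End Completeness.

(** * From a model to an enumerated preorder *)

Section Model.
Variables (d : Order.disp_t) (L : porderType d) (s t : L -> L).
Hypothesis st : ch33_pair s t.
Import Order.TTheory.
Local Open Scope order_scope.

Definition run (w : seq letter) (x : L) : L := foldr (letter_act s t) x w.

Lemma run_homo w : {homo run w : x y / x <= y}.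
Proof.
case: st => sh th _ _ _; elim: w => [|a w IH] x y xy //=.
by case: a => /=; [apply: sh|apply: th]; apply: IH.
Qed.

Lemma run_lmul a i x : run (ch33_rep (lmul a i)) x = run (a :: ch33_rep i) x.
Proof.
case: st => sh th le_st s3 t3.
have sss y : s (s (s y)) = s y := s3 y.
have ttt y : t (t (t y)) = t y := t3 y.
(* [stt = ssstt <= ssttt = sst], and the converse is [s <= t]; [tts] is dual. *)
have stt y : s (t (t y)) = s (s (t y)).
  apply: le_anti; apply/andP; split; last exact/sh/le_st.
  by rewrite -(sss (t (t y))) -{2}(ttt y); exact/sh/sh/le_st.
have tts y : t (t (s y)) = t (s (s y)).
  apply: le_anti; apply/andP; split; last exact/th/le_st.
  by rewrite -(ttt (s (s y))) -{1}(sss y); exact/th/th/le_st.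
(* [stst <= sttt = st] and [st = ssst <= stst]; [tsts] is dual. *)
have stst y : s (t (s (t y))) = s (t y).
  apply: le_anti; apply/andP; split.
    by rewrite -{2}(ttt y); apply/sh/th/le_st.
  by rewrite -{1}(sss (t y)); apply/sh/le_st.
have tsts y : t (s (t (s y))) = t (s y).
  apply: le_anti; apply/andP; split.
    by rewrite -{2}(ttt (s y)); apply/th/le_st.
  by rewrite -{1}(sss y); apply/th/sh/le_st.
have stss y : s (t (s (s y))) = s (s (t (s y))) by rewrite -stt tts.
have stsst y : s (t (s (s (t y)))) = s (s (t y)) by rewrite -stt stst.
have tssts y : t (s (s (t (s y)))) = t (s (s y)) by rewrite -tts tsts.
by case: a; do 12?[case: i => [|i]] => //=; rewrite /ch33_rep /= ?nth_nil
    ?(sss, ttt, tts, stst, tsts, stsst, tssts, stss, stt).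
Qed.

Lemma run_nf w x : run (ch33_rep (nf w)) x = run w x.
Proof. by elim: w => //= a w IH; rewrite run_lmul //= IH. Qed.

Lemma run_mul i j x :
  run (ch33_rep (mul i j)) x = run (ch33_rep i) (run (ch33_rep j) x).
Proof.
by rewrite /mul; elim: (ch33_rep i) => //= a w IH; rewrite run_lmul //= IH.
Qed.

(** Completeness is applied to the pointwise order; antisymmetry of [L] turns its kernel into
    equality of maps. *)
Lemma collapse_orders : exists2 m, m \in orders &
  forall w1 w2 : word, collapse s t w1 w2 <-> kernel_rel m w1 w2.
Proof.
pose P i j := forall x, run (ch33_rep i) x <= run (ch33_rep j) x.
have Ptr i j k : P i j -> P j k -> P i k.
  by move=> ij jk x; apply: le_trans (ij x) (jk x).
have Pmul u v i j : P i j -> P (mul u (mul i v)) (mul u (mul j v)).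
  by move=> ij x; rewrite !run_mul; exact: run_homo.
have Pst : P 0%N 1%N by case: st.
have [m mo mP] := @orders_complete P (fun i x => lexx _) Ptr Pmul Pst.
exists m => // w1 w2; rewrite /kernel_rel mP ?nf_word_lt //.
split=> [w12|[le12 le21] x].
  by split=> x; rewrite !run_nf; have := w12 x; rewrite /act /run => ->.
by apply: le_anti; rewrite /act -!/(run _ x) -!(run_nf (val _)) le12 le21.
Qed.

End Model.

(** * Realisation of a valid preorder on sets of words *)

Section OrderModel.
Variable m : matrix.
Hypothesis mV : valid m.
Implicit Types (u v w : seq letter) (A : set (seq letter)).

Let Q u v := get m (nf u) (nf v).

Lemma valid_refl u : Q u u.
Proof.
have /andP[/allP h _] := mV.
by have /andP[] := h (nf u) (etrans (iota13 _) (nf_lt u)).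
Qed.

Lemma valid_st u : Q (letter_s :: u) (letter_t :: u).
Proof.
have /andP[/allP h _] := mV.
by have /andP[] := h (nf u) (etrans (iota13 _) (nf_lt u)).
Qed.

Lemma valid_rules u v : Q u v ->
  [/\ forall w, Q v w -> Q u w, forall a, Q (a :: u) (a :: v)
    & forall w, Q (u ++ w) (v ++ w)].
Proof.
have mem w : nf w \in iota 0 13 by rewrite iota13 nf_lt.
have /andP[_ /allP/(_ _ (mem u))/allP/(_ _ (mem v))/implyP h] := mV.
move=> /h/and4P[/allP tr hs ht /allP r]; split=> [w||w].
- by move/implyP: (tr _ (mem w)).
- by case.
- by rewrite /Q !nf_cat; apply: r.
Qed.

Lemma valid_trans v u w : Q u v -> Q v w -> Q u w.
Proof. by move=> /valid_rules[h _ _]; apply: h. Qed.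

Lemma valid_cons a u v : Q u v -> Q (a :: u) (a :: v).
Proof. by move=> /valid_rules[_ h _]. Qed.

Lemma valid_cat w u v : Q u v -> Q (u ++ w) (v ++ w).
Proof. by move=> /valid_rules[_ _ h]. Qed.

Definition shift a A : set (seq letter) :=
  [set u | exists2 v, A v & Q u (a :: v)].

Let sh := shift letter_s.
Let th := shift letter_t.

(** Left compatibility and transitivity absorb the intermediate down-closures into a single final
    one. *)
Lemma act_shift (w : word) A :
  act sh th w A = [set u | exists2 v, A v & Q u (val w ++ v)].
Proof.
have letterE a : letter_act sh th a = shift a by case: a.
case: w => -[//|a w] wn; rewrite /act /= {wn}.
(* The induction starts at one letter: the empty word would act as the identity, without
   down-closure. *)
elim: w a => [|b w IH] a /=; first by rewrite letterE.
rewrite IH letterE; apply/seteqP; split=> u [v].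
  by move=> [x Ax vx uv]; exists x => //; apply: valid_trans uv (valid_cons _ vx).
by move=> Av uv; exists (b :: w ++ v) => //; exists v => //; apply: valid_refl.
Qed.

Lemma shift_pair : ch33_pair sh th.
Proof.
have homo a A B : A `<=` B -> shift a A `<=` shift a B.
  by move=> AB u [v Av uv]; exists v => //; apply: AB.
have cube a A : shift a (shift a (shift a A)) = shift a A.
  have aaa v : nf [:: a, a, a & v] = nf (a :: v).
    by rewrite -(cat1s a v) nf_cat -2!cat_cons nf_cat; case: a.
  apply/seteqP; split=> u.
    move=> [v [v1 [v2 Av2 v12] vv1] uv]; exists v2 => //.
    rewrite /Q -aaa; apply: valid_trans uv (valid_cons _ _).
    exact: valid_trans vv1 (valid_cons _ v12).
  move=> [v Av uv]; exists [:: a, a & v]; last by rewrite /Q aaa.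
  exists (a :: v); last exact: valid_refl.
  by exists v => //; apply: valid_refl.
split=> [A B||A|A|A]; rewrite ?subsetEset; try exact: homo; try exact: cube.
- by move=> A B; rewrite !subsetEset; apply: homo.
- by move=> u [v Av uv]; exists v => //; apply: valid_trans uv (valid_st v).
Qed.

(** The image of the singleton of the empty word is the down-set of the acting word, which recovers
    [Q]. The converse is right compatibility. *)
Lemma collapse_shift (w1 w2 : word) :
  collapse sh th w1 w2 <-> kernel_rel m w1 w2.
Proof.
split=> [w12|/andP[w12 w21] A].
  have sub (x y : word) : act sh th x [set [::]] = act sh th y [set [::]] ->
      Q (val x) (val y).
    rewrite !act_shift => /seteqP[xy _].
    have [|v -> ] := xy (val x); last by rewrite cats0.
    by exists [::] => //; rewrite cats0 valid_refl.
  by rewrite /kernel_rel -!/(Q _ _) !sub.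
rewrite !act_shift; apply/seteqP; split=> u [v Av uv]; exists v => //.
  exact: valid_trans uv (valid_cat _ w12).
exact: valid_trans uv (valid_cat _ w21).
Qed.

End OrderModel.

(** * Counting the collapses on words *)

Lemma kernel_rel_inj m1 m2 : kernel_rel m1 = kernel_rel m2 ->
  kernel m1 = kernel m2.
Proof.
(* Each index below 12 is the normal form of a nonempty word, so the relation on words determines
   the Boolean table. *)
move=> m12; have nfW i : i < 12 -> exists w : word, nf (val w) = i.
  move=> i12; have ne : ch33_rep i != [::] by move: i i12; do 12?case=> //.
  by exists (exist (fun w => w != [::]) _ ne); apply: nf_rep.
rewrite /kernel; apply/eq_in_allpairs => i j.
rewrite !iota12 => /nfW[w1 <-] /nfW[w2 <-].
by apply/idP/idP; rewrite -!/(is_true _) -!/(kernel_rel _ w1 w2) m12.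
Qed.

Lemma global_collapsesE :
  global_collapses = (kernel_rel \o nth [::] orders) @` `I_52.
Proof.
have /andP[/eqP so _] := orders_check.
apply/seteqP; split=> R.
  move=> [d [L [s [t [st ->]]]]]; have [m mo mP] := collapse_orders st.
  exists (index m orders); first by rewrite /= -so index_mem.
  rewrite [LHS]/= nth_index //.
  by apply/funext => w1; apply/funext => w2; apply/propext; rewrite mP.
move=> [k /= k52 <-].
have mV : valid (nth [::] orders k).
  by apply: orders_valid; apply: mem_nth; rewrite so.
move: (nth _ _ _) mV => m mV.
(* The inferred poset consists of all sets of words under inclusion. *)
exists _, _, (shift m letter_s), (shift m letter_t); split.
  exact: shift_pair.
apply/funext => w1; apply/funext => w2; apply/propext.
by rewrite collapse_shift.
Qed.

Lemma card_global_collapses : global_collapses #= `I_52.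
Proof.
rewrite global_collapsesE; apply: inj_card_eq => i j.
rewrite !inE /= => i52 j52 /kernel_rel_inj.
have /and3P[/eqP so uo _] := orders_check.
rewrite -!(nth_map [::] [::]) ?so // => /eqP.
by rewrite nth_uniq ?size_map ?so // => /eqP.
Qed.

(** * Transfer to the quotient *)

Definition lift_Ch33 (R : word -> word -> Prop) (c1 c2 : Ch33) : Prop :=
  R (repr c1) (repr c2).

Lemma global_collapses_Ch33E :
  global_collapses_Ch33 = lift_Ch33 @` global_collapses.
Proof.
apply/seteqP; split=> R.
  move=> [d [L [s [t [st ->]]]]]; exists (collapse s t) => //.
  by exists d, L, s, t.
by move=> [_ [d [L [s [t [st ->]]]]] <-]; exists d, L, s, t.
Qed.

(** A collapse contains the universal identities, so it can be read back from its values on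
    classes. *)
Lemma lift_Ch33_inj : {in global_collapses &, injective lift_Ch33}.
Proof.
have repr_pi d (L : porderType d) (s t : L -> L) (st : ch33_pair s t) w1 w2 :
    collapse s t w1 w2 =
    lift_Ch33 (collapse s t) (\pi_Ch33%qT w1) (\pi_Ch33%qT w2).
  by apply/propext; split=> h x; have := h x;
    rewrite -!/(act_Ch33 s t _ x) !act_Ch33_pi.
move=> R1 R2; rewrite !inE => -[d1 [L1 [s1 [t1 [st1 ->]]]]].
move=> [d2 [L2 [s2 [t2 [st2 ->]]]]] E; apply/funext => w1; apply/funext => w2.
by rewrite (repr_pi _ _ _ _ st1) (repr_pi _ _ _ _ st2) E.
Qed.

Theorem theorem5 :
  (global_collapses #= `I_52) /\ (global_collapses_Ch33 #= `I_52).
Proof.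
split; first exact: card_global_collapses.
rewrite global_collapses_Ch33E.
exact: card_eq_trans (inj_card_eq lift_Ch33_inj) card_global_collapses.
Qed.
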